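(* Let $(E, \|\cdot\|_E, \tau)$ be a truncated normed Riesz space such that $\tau$ is not unital and $\|\cdot\|_E$ is an $M$-norm. Then the smallest truncation unitization norm on $E \oplus \mathbb{R}$, namely $$\|x+r\|_S = \sup\{ \|g\|_E : g \in E \text{ and } |g| \le |x+r| \} \qquad (x \in E,\ r \in \mathbb{R}),$$ is an $M$-norm on $E \oplus \mathbb{R}$.
   Context: All Riesz spaces are real. A truncation on a Riesz space $E$ is a map $\tau : E^{+} \to E^{+}$ such that $\tau(f) \wedge g = f \wedge \tau(g)$ for all $f, g \in E^{+}$; put $[\tau] = \{f \in E^{+} : \tau(f) = f\}$. It is unital if there is $u \in E^{+}$ with $\tau(f) = u \wedge f$ for all $f \in E^{+}$. A truncated normed Riesz space is a triple $(E, \|\cdot\|_E, \tau)$ where $E$ is a Riesz space, $\|\cdot\|_E$ is a lattice norm on $E$, and $\tau$ is a truncation on $E$ such that $\tau(f)=0$ implies $f=0$, and $\sup\{\|\tau(f)\|_E : f \in E^{+}\} = 1$. The canonical (Alexandroff) unitization $E \oplus \mathbb{R}$ is the direct sum vector space (elements written $x + r$ with $x \in E$, $r \in \mathbb{R}$), which is a Riesz space under the positive cone $$(E \oplus \mathbb{R})^{+} = E^{+} \cup \Big\{ x + \lambda : 0 < \lambda \in \mathbb{R},\ x \in E,\ \tfrac{1}{\lambda} x^{-} \in [\tau] \Big\};$$ it contains $E$ as an ideal. A truncation unitization norm is a lattice norm $\|\cdot\|_U$ on $E \oplus \mathbb{R}$ with $\|0+1\|_U = 1$ and $\|x\|_U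 = \|x\|_E$ for $x \in E$. It is a known fact that, when $\tau$ is not unital, $\|\cdot\|_S$ is the smallest truncation unitization norm. A lattice norm is an $M$-norm if $\|x \vee y\| = \max(\|x\|, \|y\|)$ whenever $x \wedge y = 0$. *)

(* Defs.v *)
From HB Require Import structures.
From mathcomp Require Import all_boot all_order all_algebra.
From mathcomp Require Import boolp classical_sets reals.

Set Implicit Arguments.
Unset Strict Implicit.
Unset Printing Implicit Defensive.
Import Order.TTheory GRing.Theory Num.Theory.

Local Open Scope classical_set_scope.
Local Open Scope ring_scope.

(** * Riesz spaces *)

(* The lattice operations are fields of the mixin, instead of an inherited
   [Order.Lattice], because the latter would need joins with the structures
   below [Num.RealDomain]. The [Order.Lattice] instance is declared on the
   generic carrier below, and the library notations are used from then on. *)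
HB.mixin Record isRieszSpace (R : realType) E
    of GRing.Lmodule R E & Num.POrderedZmodule E := {
  riesz_meet : E -> E -> E;
  riesz_join : E -> E -> E;
  riesz_meetP : forall x y z : E, (x <= riesz_meet y z) = (x <= y) && (x <= z);
  riesz_joinP : forall x y z : E, (riesz_join x y <= z) = (x <= z) && (y <= z);
  riesz_leD2r : forall z x y : E, x <= y -> x + z <= y + z;
  riesz_scale_ge0 : forall (a : R) (x : E), 0 <= a -> 0 <= x -> 0 <= a *: x
}.

#[short(type="rieszType")]
HB.structure Definition RieszSpace (R : realType) :=
  {E of GRing.Lmodule R E & Num.POrderedZmodule E & isRieszSpace R E}.

#[non_forgetful_inheritance]
HB.instance Definition _ (R : realType) (E : rieszType R) :=
  Order.POrder_MeetJoin_isLattice.Build ring_display (RieszSpace.sort E)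
    (@riesz_meetP R E) (@riesz_joinP R E).

Section RieszDefs.
Context {R : realType} {E : rieszType R}.

Definition riesz_abs (x : E) : E := (x `|` (- x))%O.
Definition riesz_pos (x : E) : E := (x `|` 0)%O.
Definition riesz_neg (x : E) : E := ((- x) `|` 0)%O.

Record lattice_norm (N : E -> R) : Prop := LatticeNorm {
  lattice_norm_eq0 : forall x, N x = 0 -> x = 0;
  lattice_normZ : forall (a : R) x, N (a *: x) = `|a| * N x;
  lattice_normD : forall x y, N (x + y) <= N x + N y;
  lattice_norm_le : forall x y, riesz_abs x <= riesz_abs y -> N x <= N y
}.

Definition M_norm (N : E -> R) : Prop :=
  lattice_norm N /\
  forall x y : E, (x `&` y)%O = 0 -> N (x `|` y)%O = Num.max (N x) (N y).

End RieszDefs.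

Section RieszTheory.
Context {R : realType} {E : rieszType R}.
Implicit Types (x y z : E) (a : R).

Lemma riesz_leD2 z x y : (x + z <= y + z) = (x <= y).
Proof.
apply/idP/idP; last exact: riesz_leD2r.
by move/(riesz_leD2r (- z)); rewrite !addrK.
Qed.

Lemma riesz_leD2l z x y : (z + x <= z + y) = (x <= y).
Proof. by rewrite ![z + _]addrC riesz_leD2. Qed.

Lemma riesz_subr_ge0 x y : (0 <= y - x) = (x <= y).
Proof. by rewrite -(riesz_leD2 x 0) add0r subrK. Qed.

Lemma riesz_leBlDr x y z : (x - y <= z) = (x <= z + y).
Proof. by rewrite -(riesz_leD2 y (x - y)) subrK. Qed.

Lemma riesz_addr_ge0 x y : 0 <= x -> 0 <= y -> 0 <= x + y.
Proof.
by move=> x0 y0; apply: le_trans y0 _; rewrite -[leLHS]add0r riesz_leD2.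
Qed.

Lemma riesz_ler_wpZ2l a x y : 0 <= a -> x <= y -> a *: x <= a *: y.
Proof.
move=> a0 xy; rewrite -riesz_subr_ge0 -scalerBr; apply: riesz_scale_ge0 => //.
by rewrite riesz_subr_ge0.
Qed.

Lemma riesz_pos_ge0 x : 0 <= riesz_pos x.
Proof. exact: leUr. Qed.

Lemma riesz_neg_ge0 x : 0 <= riesz_neg x.
Proof. exact: leUr. Qed.

Lemma riesz_le_pos x : x <= riesz_pos x.
Proof. exact: leUl. Qed.

End RieszTheory.

(** * Truncations *)

(* A truncation is a map on the positive cone only: the values of [trunc_fun]
   outside of the cone are unconstrained and never used. *)
Record truncation (R : realType) (E : rieszType R) := Truncation {
  trunc_fun :> E -> E;
  trunc_ge0 : forall f, 0 <= f -> 0 <= trunc_fun f;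
  truncP : forall f g, 0 <= f -> 0 <= g ->
    (trunc_fun f `&` g)%O = (f `&` trunc_fun g)%O
}.

Section TruncDefs.
Context {R : realType} {E : rieszType R}.
Implicit Types tau : truncation E.

Definition trunc_fixed tau : pred E := fun f => (0 <= f) && (tau f == f).

Definition unital tau : Prop :=
  exists u : E, 0 <= u /\ forall f, 0 <= f -> tau f = (u `&` f)%O.

(* [sup] is [0] on sets without a supremum, so the last field also says that
   the norms of the truncated elements are bounded. *)
Record truncated_normed (nE : E -> R) tau : Prop := TruncatedNormed {
  truncated_normed_norm : lattice_norm nE;
  truncated_normed_eq0 : forall f, 0 <= f -> tau f = 0 -> f = 0;
  truncated_normed_sup : sup [set nE (tau f) | f in [set f : E | 0 <= f]] = 1
}.

End TruncDefs.

Section TruncTheory.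
Context {R : realType} {E : rieszType R} (tau : truncation E).
Implicit Types f g h m : E.

Lemma trunc_le f : 0 <= f -> tau f <= f.
Proof.
move=> f0; have := truncP tau f0 (trunc_ge0 tau f0).
by rewrite meetxx => ->; exact: leIl.
Qed.

Lemma trunc_fixed_trunc f : 0 <= f -> trunc_fixed tau (tau f).
Proof.
move=> f0; have t0 := trunc_ge0 tau f0; rewrite /trunc_fixed t0 /=.
apply/eqP/le_anti; rewrite trunc_le //=.
by have := truncP tau f0 t0; rewrite meetxx => {1}->; exact: leIr.
Qed.

Lemma trunc_fixed0 : trunc_fixed tau 0.
Proof.
rewrite /trunc_fixed lexx /=; apply/eqP/le_anti.
by rewrite trunc_le // trunc_ge0.
Qed.

Lemma trunc_fixed_le f g : 0 <= f -> f <= g -> trunc_fixed tau g ->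
  trunc_fixed tau f.
Proof.
move=> f0 fg /andP[g0 /eqP tg]; rewrite /trunc_fixed f0 /=.
apply/eqP/le_anti; rewrite trunc_le //=.
have := truncP tau f0 g0; rewrite tg (meet_l fg) => e.
by rewrite -{1}e; exact: leIl.
Qed.

Lemma le_trunc f g : 0 <= f -> trunc_fixed tau g -> g <= f -> g <= tau f.
Proof.
move=> f0 /andP[g0 /eqP tg] gf.
have := truncP tau f0 g0; rewrite tg (meet_r gf) => e.
by rewrite -{1}e; exact: leIl.
Qed.

Lemma trunc_fixedU f g : trunc_fixed tau f -> trunc_fixed tau g ->
  trunc_fixed tau (f `|` g)%O.
Proof.
move=> ff fg; have [f0 _] := andP ff.
have u0 : 0 <= (f `|` g)%O by apply: le_trans f0 _; exact: leUl.
rewrite /trunc_fixed u0 /=; apply/eqP/le_anti; rewrite trunc_le //= leUx.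
by rewrite !le_trunc ?leUl ?leUr.
Qed.

Lemma le_add_trunc f b m : 0 <= f -> 0 <= b -> trunc_fixed tau m ->
  f <= b + m -> f <= b + tau f.
Proof.
move=> f0 b0 fm fbm; have [m0 _] := andP fm.
have i0 : 0 <= (f `&` m)%O by rewrite lexI f0.
rewrite addrC -riesz_leBlDr; apply: (@le_trans _ _ (f `&` m)%O).
  rewrite lexI !riesz_leBlDr [m + b]addrC fbm andbT.
  by rewrite addrC -[leLHS]add0r riesz_leD2.
apply: le_trunc => //; last exact: leIl.
exact: (trunc_fixed_le i0 (leIr _ _)).
Qed.

End TruncTheory.

(** * The Alexandroff unitization *)

(* The pair [(x, r)] is the element [x + r] of the direct sum. *)
Definition unitization (R : realType) (E : rieszType R) (tau : truncation E) :
  Type := (E * R^o)%type.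

HB.instance Definition _ (R : realType) (E : rieszType R)
  (tau : truncation E) := GRing.Lmodule.on (unitization tau).

Section Unitization.
Context {R : realType} {E : rieszType R} (tau : truncation E).
Local Notation U := (unitization tau).
Implicit Types (u v w : U) (s t : R) (a x : E).

Definition unit_emb x : U := (x, 0).
Definition unit_one : U := (0, 1).

Definition unit_cone : pred U := fun u =>
  ((u.2 == 0) && (0 <= u.1)) ||
  ((0 < u.2) && trunc_fixed tau (u.2^-1 *: riesz_neg u.1)).

Lemma unit_coneP u :
  unit_cone u <-> 0 <= u.2 /\ exists2 m, trunc_fixed tau m & 0 <= u.1 + u.2 *: m.
Proof.
case: u => [a t]; rewrite /unit_cone /=; split=> [|[]].
  case/orP=> /andP[].
    move=> /eqP-> a0; split=> //; exists 0; first exact: trunc_fixed0.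
    by rewrite scaler0 addr0.
  move=> t0 ft; split; [exact: ltW|exists (t^-1 *: riesz_neg a) => //].
  rewrite scalerA divff ?gt_eqF // scale1r addrC -riesz_leBlDr sub0r.
  exact: leUl.
rewrite le_eqVlt => /orP[/eqP<-|t0] [m fm].
  by rewrite scale0r addr0 eqxx => ->.
rewrite addrC -riesz_leBlDr sub0r => am; rewrite t0 /=; apply/orP; right.
have [m0 _] := andP fm.
have nm : riesz_neg a <= t *: m.
  by rewrite leUx am riesz_scale_ge0 ?(ltW t0).
apply: (trunc_fixed_le _ _ fm).
  by apply: riesz_scale_ge0 (riesz_neg_ge0 _); rewrite invr_ge0 ltW.
have -> : m = t^-1 *: (t *: m) by rewrite scalerA mulVf ?gt_eqF ?scale1r.
by apply: riesz_ler_wpZ2l => //; rewrite invr_ge0 ltW.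
Qed.

Lemma unit_cone0 : unit_cone 0.
Proof. by rewrite /unit_cone eqxx lexx. Qed.

Lemma unit_cone_emb x : 0 <= x -> unit_cone (unit_emb x).
Proof. by rewrite /unit_cone eqxx => ->. Qed.

Lemma unit_coneD u v : unit_cone u -> unit_cone v -> unit_cone (u + v).
Proof.
move=> /unit_coneP[s0 [m fm Hm]] /unit_coneP[t0 [n fn Hn]].
apply/unit_coneP; split; first exact: addr_ge0.
exists (m `|` n)%O; first exact: trunc_fixedU.
rewrite /= scalerDl addrACA; apply: riesz_addr_ge0.
  apply: le_trans Hm _; rewrite riesz_leD2l.
  by apply: riesz_ler_wpZ2l => //; exact: leUl.
apply: le_trans Hn _; rewrite riesz_leD2l.
by apply: riesz_ler_wpZ2l => //; exact: leUr.
Qed.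

Lemma unit_coneZ s u : 0 <= s -> unit_cone u -> unit_cone (s *: u).
Proof.
move=> s0 /unit_coneP[t0 [m fm Hm]]; apply/unit_coneP.
split; first exact: mulr_ge0.
by exists m => //=; rewrite -scalerA -scalerDr; exact: riesz_scale_ge0.
Qed.

Lemma unit_cone_anti u : unit_cone u -> unit_cone (- u) -> u = 0.
Proof.
case: u => [a t] /unit_coneP[/= t0 [m fm Hm]] /unit_coneP[/= t1 [n fn Hn]].
have {t0 t1}tz : t = 0 by apply/le_anti; rewrite t0 -oppr_ge0 t1.
move: Hm Hn; rewrite tz oppr0 !scale0r !addr0 => a0 a1.
have -> : a = 0 by apply/le_anti; rewrite a0 -riesz_subr_ge0 sub0r a1.
by [].
Qed.

Definition unit_le : rel U := fun u v => unit_cone (v - u).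

Lemma unit_le_refl : reflexive unit_le.
Proof. by move=> u; rewrite /unit_le subrr unit_cone0. Qed.

Lemma unit_le_anti : antisymmetric unit_le.
Proof.
move=> u v /andP[uv vu]; apply/esym/eqP; rewrite -subr_eq0; apply/eqP.
by apply: unit_cone_anti => //; rewrite opprB.
Qed.

Lemma unit_le_trans : transitive unit_le.
Proof.
move=> v u w uv vw; rewrite /unit_le.
by have := unit_coneD vw uv; rewrite addrA subrK.
Qed.

(* For [0 <= s], this is the positive part of [x - s], which lies in [E]. *)
Definition unit_posB x s : E :=
  riesz_pos x - s *: tau (s^-1 *: riesz_pos x).

Definition unit_pos u : U :=
  if u.2 <= 0 then unit_emb (unit_posB u.1 (- u.2))
  else u + unit_emb (unit_posB (- u.1) u.2).

Lemma unit_posB_spec u : u.2 <= 0 ->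
  let p := unit_emb (unit_posB u.1 (- u.2)) in
  [/\ unit_cone p, unit_cone (p - u) &
    forall v, unit_cone v -> unit_cone (v - u) -> unit_cone (v - p)].
Proof.
case: u => [x r] /= r0; set s := - r; have s0 : 0 <= s by rewrite oppr_ge0.
have p0 := riesz_pos_ge0 x; set p := riesz_pos x in p0 *.
have q0 : 0 <= s^-1 *: p by apply: riesz_scale_ge0 => //; rewrite invr_ge0.
split.
- apply: unit_cone_emb; rewrite /unit_posB -/p riesz_subr_ge0.
  have [->|sN0] := eqVneq s 0; first by rewrite scale0r.
  have {2}-> : p = s *: (s^-1 *: p) by rewrite scalerA divff ?scale1r.
  by apply: riesz_ler_wpZ2l => //; exact: trunc_le.
- apply/unit_coneP; split; first by rewrite /= add0r.
  exists (tau (s^-1 *: p)); first exact: trunc_fixed_trunc.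
  rewrite /= add0r -/s /unit_posB -/p addrAC subrK riesz_subr_ge0.
  exact: riesz_le_pos.
case=> a t /unit_coneP[/= t0 [k fk Hk]] /unit_coneP[/= ts0 [h fh Hh]].
apply/unit_coneP; split; first by rewrite /= subr0.
have fm := trunc_fixedU fk fh; set m := (k `|` h)%O in fm.
exists m => //=; rewrite subr0 addrAC riesz_subr_ge0.
set b := a + t *: m.
have [m0 _] := andP fm.
have b0 : 0 <= b.
  apply: le_trans Hk _; rewrite riesz_leD2l.
  by apply: riesz_ler_wpZ2l => //; exact: leUl.
have pb : p <= b + s *: m.
  rewrite leUx riesz_addr_ge0 ?riesz_scale_ge0 // andbT -riesz_subr_ge0.
  apply: le_trans Hh _; rewrite /b -/s -[a + _ + _]addrA -scalerDl.
  rewrite addrAC riesz_leD2 riesz_leD2l.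
  by apply: riesz_ler_wpZ2l => //; exact: leUr.
rewrite /unit_posB -/p riesz_leBlDr.
move: s0; rewrite le_eqVlt => /orP[/eqP sz|s0].
  by move: pb; rewrite -sz !scale0r.
have sN0 : s != 0 by rewrite gt_eqF.
have sV0 : 0 <= s^-1 by rewrite invr_ge0 ltW.
have : s^-1 *: p <= s^-1 *: b + m.
  have -> : m = s^-1 *: (s *: m) by rewrite scalerA mulVf ?scale1r.
  by rewrite -scalerDr; exact: riesz_ler_wpZ2l.
move/(le_add_trunc q0 (riesz_scale_ge0 _ _ sV0 b0) fm).
move/(riesz_ler_wpZ2l (ltW s0)).
by rewrite scalerDr !scalerA divff // !scale1r.
Qed.

Lemma unit_pos_spec u :
  [/\ unit_cone (unit_pos u), unit_cone (unit_pos u - u) &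
    forall v, unit_cone v -> unit_cone (v - u) -> unit_cone (v - unit_pos u)].
Proof.
rewrite /unit_pos; case: ifPn => [|]; first exact: unit_posB_spec.
rewrite -ltNge => r0; have n0 : (- u).2 <= 0 by rewrite oppr_le0 ltW.
have /= := unit_posB_spec n0; rewrite opprK => -[h1 h2 h3].
split; [by rewrite addrC -[u in _ + u]opprK|by rewrite addrC addKr|].
move=> v v0 vu; rewrite opprD addrA; apply: h3 => //.
by rewrite opprK subrK.
Qed.

Definition unit_join u v : U := u + unit_pos (v - u).
Definition unit_meet u v : U := - unit_join (- u) (- v).

Lemma unit_joinP u v w :
  unit_le (unit_join u v) w = unit_le u w && unit_le v w.
Proof.
have [h1 h2 h3] := unit_pos_spec (v - u).
have lu : unit_le u (unit_join u v) by rewrite /unit_le addrC addKr.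
have lv : unit_le v (unit_join u v).
  by move: h2; rewrite /unit_le /unit_join opprB addrA [unit_pos _ + u]addrC.
apply/idP/andP => [h|[uw vw]].
  by rewrite (unit_le_trans lu h) (unit_le_trans lv h).
rewrite /unit_le opprD addrA; apply: h3 => //.
by rewrite opprB addrA subrK.
Qed.

Lemma unit_meetP u v w :
  unit_le u (unit_meet v w) = unit_le u v && unit_le u w.
Proof.
have lN (y z : U) : unit_le (- y) (- z) = unit_le z y by rewrite /unit_le opprK addrC.
by rewrite -lN opprK unit_joinP !lN.
Qed.

HB.instance Definition _ := Order.Le_isPOrder.Build ring_display U
  unit_le_refl unit_le_anti unit_le_trans.

Lemma unit_leE u v : (u <= v) = unit_cone (v - u).
Proof. by []. Qed.

Lemma unit_leD2r w u v : u <= v -> u + w <= v + w.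
Proof. by rewrite !unit_leE opprD addrACA subrr addr0. Qed.

Lemma unit_scale_ge0 s u : 0 <= s -> 0 <= u -> 0 <= s *: u.
Proof. by rewrite !unit_leE !subr0; exact: unit_coneZ. Qed.

HB.instance Definition _ := isRieszSpace.Build R U
  unit_meetP unit_joinP unit_leD2r unit_scale_ge0.

Lemma unit_ge0E u : (0 <= u) = unit_cone u.
Proof. by rewrite unit_leE subr0. Qed.

Definition truncation_unitization_norm (nE : E -> R) (N : U -> R) : Prop :=
  [/\ lattice_norm N, N unit_one = 1 & forall x, N (unit_emb x) = nE x].

Definition smallest_truncation_unitization_norm (nE : E -> R) (N : U -> R) :
    Prop :=
  truncation_unitization_norm nE N /\
  forall N', truncation_unitization_norm nE N' -> forall u, N u <= N' u.

Definition norm_S (nE : E -> R) (u : U) : R :=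
  sup [set nE g | g in [set g : E | riesz_abs (unit_emb g) <= riesz_abs u]].

End Unitization.

Arguments norm_S {R E} tau nE u.

(* Main.v *)
From HB Require Import structures.
Require Import Defs.
From mathcomp Require Import all_boot all_order all_algebra reals.
From mathcomp Require Import boolp classical_sets.
Import Order.TTheory GRing.Theory Num.Theory.
Local Open Scope ring_scope.

(** The idea throughout is that [E] is an ideal of its unitization [U], so the
    supremum defining the norm of [u] can be computed with elements [h >= 0] of
    [E] below [|u|], and that whatever lies in [U] between elements of [E] is
    again in [E].

    The supremum is finite because [h <= |x| + |r| 1] in [U] means
    [h <= |x| + |r| m] in [E] for some [m] fixed by [tau], and the fixed elements
    are exactly the truncated ones, whose norms have supremum [1]; this
    also gives the value at the unit ([norm_S_bound], [norm_S_one]). The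
    triangle inequality is Riesz decomposition, in the form
    [h <= (h /\ a) + (h /\ b)] whenever [h <= a + b] ([riesz_meet_subadd]): both
    meets lie in [E]. Minimality holds because any lattice norm extending that
    of [E] dominates [nE g] at every [u] with [|g| <= |u|].

    Definiteness is where non-unitality enters. If the norm of [u] vanishes then
    no nonzero positive element of [E] lies below [|u|]. If [|u|] had a nonzero
    real part, one could rescale it to [y + 1]; its positivity puts [y^-] in the
    fixed set, and for every truncated element [t] the element
    [(t \/ y^-) - y^-] lies below [y + 1], hence is zero. So
    [y^-] would be the largest fixed element, and [tau] would be the meet with it
    ([unital_of_minorants_eq0]).

    Finally, if [a] and [b] are disjoint in [U] and [0 <= h <= a \/ b], then
    [h /\ a] and [h /\ b] are disjoint elements of [E] with join [h], so the
    [M]-property of [nE] bounds [nE h] by the larger of the norms of [a] and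
    [b]. *)

(** * Absolute values, disjointness and lattice norms in Riesz spaces *)

Section RieszFacts.
Context {R : realType} {E : rieszType R}.
Implicit Types (x y z : E) (a : R).

Lemma riesz_leD x1 x2 y1 y2 : x1 <= y1 -> x2 <= y2 -> x1 + x2 <= y1 + y2.
Proof.
move=> h1 h2; apply: (@le_trans _ _ (y1 + x2)); first by rewrite riesz_leD2.
by rewrite riesz_leD2l.
Qed.

Lemma riesz_leN2 x y : (- x <= - y) = (y <= x).
Proof.
by rewrite -(riesz_subr_ge0 (- x)) opprK addrC riesz_subr_ge0.
Qed.

Lemma riesz_le_abs x : x <= riesz_abs x.
Proof. exact: leUl. Qed.

Lemma riesz_leN_abs x : - x <= riesz_abs x.
Proof. exact: leUr. Qed.

Lemma riesz_abs_le x y : x <= y -> - x <= y -> riesz_abs x <= y.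
Proof. by move=> h1 h2; rewrite /riesz_abs leUx h1 h2. Qed.

Lemma riesz_abs_ge0 x : 0 <= riesz_abs x.
Proof.
have h : 0 <= riesz_abs x + riesz_abs x.
  rewrite -(subrr x); apply: riesz_leD; first exact: riesz_le_abs.
  exact: riesz_leN_abs.
have -> : riesz_abs x = 2^-1 *: (riesz_abs x + riesz_abs x).
  rewrite -{2 3}(scale1r (riesz_abs x)) -scalerDl scalerA mulVf ?scale1r //.
  by rewrite pnatr_eq0.
by apply: riesz_scale_ge0 => //; rewrite invr_ge0 ler0n.
Qed.

Lemma riesz_abs_id x : 0 <= x -> riesz_abs x = x.
Proof.
move=> x0; apply/le_anti; rewrite riesz_le_abs andbT riesz_abs_le //.
by apply: (le_trans _ x0); rewrite -oppr0 riesz_leN2.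
Qed.

Lemma riesz_abs_idem x : riesz_abs (riesz_abs x) = riesz_abs x.
Proof. exact/riesz_abs_id/riesz_abs_ge0. Qed.

Lemma riesz_abs0_eq x : riesz_abs x = 0 -> x = 0.
Proof.
move=> h; apply/le_anti; rewrite -{1}h riesz_le_abs /=.
by rewrite -riesz_leN2 oppr0 -h riesz_leN_abs.
Qed.

Lemma riesz_absD x y : riesz_abs (x + y) <= riesz_abs x + riesz_abs y.
Proof.
apply: riesz_abs_le; first by apply: riesz_leD; exact: riesz_le_abs.
by rewrite opprD; apply: riesz_leD; exact: riesz_leN_abs.
Qed.

Lemma riesz_absZ_le a x : riesz_abs (a *: x) <= `|a| *: riesz_abs x.
Proof.
have h y : y <= riesz_abs x -> - y <= riesz_abs x ->
    a *: y <= `|a| *: riesz_abs x.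
  move=> h1 h2; have [a0|/ltW a0] := leP 0 a.
    by rewrite ger0_norm //; exact: riesz_ler_wpZ2l.
  rewrite ler0_norm // -[y]opprK scalerN -scaleNr.
  by apply: riesz_ler_wpZ2l; rewrite ?oppr_ge0.
apply: riesz_abs_le; first by apply: h (riesz_le_abs x) (riesz_leN_abs x).
by rewrite -scalerN; apply: h; rewrite ?opprK ?riesz_le_abs ?riesz_leN_abs.
Qed.

(** A form of Riesz decomposition: [h - (h /\ y)] is at most [h], and at most
    [x] because [h - x] is a lower bound of [h] and [y]. *)
Lemma riesz_meet_subadd h x y : 0 <= h -> 0 <= x -> 0 <= y -> h <= x + y ->
  h <= (h `&` x)%O + (h `&` y)%O.
Proof.
move=> h0 x0 y0 hxy; rewrite -riesz_leBlDr lexI; apply/andP; split.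
  by rewrite riesz_leBlDr -{1}[h]addr0 riesz_leD2l lexI h0.
rewrite riesz_leBlDr addrC -riesz_leBlDr lexI !riesz_leBlDr.
by rewrite -{1}[h]addr0 riesz_leD2l x0 addrC.
Qed.

Lemma riesz_disjointD x y : (x `&` y)%O = 0 -> x + y <= (x `|` y)%O.
Proof.
move=> d; have : x + y - (x `|` y)%O <= (x `&` y)%O.
  rewrite lexI !riesz_leBlDr riesz_leD2l leUr /= addrC riesz_leD2l.
  exact: leUl.
by rewrite d riesz_leBlDr add0r.
Qed.

Lemma riesz_joinD x y : 0 <= x -> 0 <= y -> (x `|` y)%O <= x + y.
Proof.
move=> x0 y0; rewrite leUx -{1}[x]addr0 riesz_leD2l y0 /=.
by rewrite -{1}[y]add0r riesz_leD2.
Qed.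

(** Distributivity in the disjoint case, where joins are sums
    ([riesz_disjointD], [riesz_joinD]) and decomposition applies. *)
Lemma disjoint_meets_join h x y : 0 <= h -> (x `&` y)%O = 0 ->
  h <= (x `|` y)%O ->
  ((h `&` x) `&` (h `&` y))%O = 0 /\ ((h `&` x) `|` (h `&` y))%O = h.
Proof.
move=> h0 d hj.
have x0 : 0 <= x by rewrite -d leIl.
have y0 : 0 <= y by rewrite -d leIr.
have dm : ((h `&` x) `&` (h `&` y))%O = 0.
  apply/le_anti/andP; split; last by rewrite !lexI h0 x0 y0.
  rewrite -d lexI; apply/andP; split.
    exact: le_trans (leIl _ _) (leIr _ _).
  exact: le_trans (leIr _ _) (leIr _ _).
split=> //; apply/le_anti; rewrite leUx !leIl /=.
apply: le_trans (riesz_disjointD _ _ dm).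
apply: riesz_meet_subadd => //.
exact: le_trans hj (riesz_joinD _ _ x0 y0).
Qed.

Section LatticeNorm.
Context {N : E -> R} (HN : lattice_norm N).

Lemma lattice_norm0 : N 0 = 0.
Proof. by rewrite -(scale0r 0) lattice_normZ // normr0 mul0r. Qed.

Lemma lattice_norm_ge0 x : 0 <= N x.
Proof.
rewrite -lattice_norm0; apply: lattice_norm_le => //.
by rewrite riesz_abs_id ?riesz_abs_ge0.
Qed.

Lemma lattice_norm_abs x : N (riesz_abs x) = N x.
Proof.
by apply/le_anti/andP; split; apply: lattice_norm_le => //;
  rewrite riesz_abs_idem.
Qed.

Lemma lattice_norm_mono x y : 0 <= x -> x <= y -> N x <= N y.
Proof.
move=> x0 xy; apply: lattice_norm_le => //.
by rewrite !riesz_abs_id // (le_trans x0 xy).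
Qed.

End LatticeNorm.
End RieszFacts.

(** * A Riesz space as an ideal of its unitization *)

(** The lattice structure of a Riesz space is attached to the generic carrier;
    restating it on the unitization lets meets and joins be written there. *)
HB.instance Definition _ (R : realType) (E : rieszType R) (tau : truncation E)
  := Order.Lattice.copy (unitization tau)
       (RieszSpace.sort (unitization tau : rieszType R)).

Section UnitizationFacts.
Context {R : realType} {E : rieszType R} {tau : truncation E}.
Local Notation U := (unitization tau).
Local Notation emb := (unit_emb tau).
Local Notation one := (unit_one tau).
Implicit Types (u v w : U) (x y g h : E) (a r : R).

Lemma unit_emb_le x y : (emb x <= emb y) = (x <= y).
Proof.
by rewrite unit_leE /unit_cone /= subrr eqxx ltxx /= orbF riesz_subr_ge0.
Qed.

Lemma unit_emb_ge0 x : (0 <= emb x) = (0 <= x).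
Proof. exact: (unit_emb_le 0 x). Qed.

Lemma unit_embN x : - emb x = emb (- x).
Proof. by congr pair; rewrite oppr0. Qed.

Lemma unit_embZ a x : a *: emb x = emb (a *: x).
Proof. by congr pair; rewrite /= scaler0. Qed.

Lemma unit_decomp u : u = emb u.1 + u.2 *: one.
Proof.
case: u => x r; congr pair => /=; first by rewrite scaler0 addr0.
by rewrite add0r /GRing.scale /= mulr1.
Qed.

Lemma unit_le_snd u v : u <= v -> u.2 <= v.2.
Proof. by rewrite unit_leE => /unit_coneP[] /=; rewrite subr_ge0. Qed.

(** Convexity of [E] in [U]: the real part is monotone. *)
Lemma unit_emb_convex x y u : emb x <= u -> u <= emb y -> u = emb u.1.
Proof.
move=> /unit_le_snd /= u0 /unit_le_snd /= u1; case: u u0 u1 => z r /= u0 u1.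
by congr pair; apply/le_anti; rewrite u0 u1.
Qed.

Lemma unit_emb_abs x : riesz_abs (emb x) = emb (riesz_abs x).
Proof.
have le : riesz_abs (emb x) <= emb (riesz_abs x).
  by apply: riesz_abs_le; rewrite ?unit_embN unit_emb_le
    ?riesz_le_abs ?riesz_leN_abs.
have e := unit_emb_convex x _ _ (riesz_le_abs (emb x)) le.
apply/le_anti; rewrite le /= e unit_emb_le; apply: riesz_abs_le.
  by rewrite -unit_emb_le -e riesz_le_abs.
by rewrite -unit_emb_le -e -unit_embN riesz_leN_abs.
Qed.

Lemma unit_one_ge0 : 0 <= one.
Proof.
rewrite unit_ge0E; apply/unit_coneP; split; first exact: ler01.
by exists 0; [exact: trunc_fixed0 | rewrite /= scaler0 addr0].
Qed.

Lemma unit_emb_meet h u : 0 <= h -> 0 <= u ->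
  exists2 a : E, 0 <= a & (emb h `&` u)%O = emb a.
Proof.
move=> h0 u0; have m0 : emb 0 <= (emb h `&` u)%O.
  by rewrite lexI unit_emb_le h0.
have e := unit_emb_convex _ _ _ m0 (leIl _ _).
by exists ((emb h `&` u)%O : U).1; rewrite // -unit_emb_le -e.
Qed.

Lemma unit_abs_le u : riesz_abs u <= emb (riesz_abs u.1) + `|u.2| *: one.
Proof.
rewrite {1}(unit_decomp u); apply: le_trans (riesz_absD _ _) _.
rewrite unit_emb_abs riesz_leD2l.
by apply: le_trans (riesz_absZ_le _ _) _; rewrite riesz_abs_id // unit_one_ge0.
Qed.

Lemma unit_emb_leP h x r : emb h <= emb x + r *: one ->
  exists2 m, trunc_fixed tau m & h <= x + r *: m.
Proof.
rewrite unit_leE => /unit_coneP[_ [m fm]] /=.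
rewrite scaler0 addr0 add0r subr0 /GRing.scale /= mulr1 => hm.
by exists m => //; rewrite -riesz_subr_ge0 addrAC.
Qed.

(** With [n] the negative part of [y], positivity of [y + 1] puts [n] in the
    fixed set, and [(m \/ n) - n <= y + 1] for every fixed [m]; hence [n] is the
    largest fixed element. *)
Lemma unital_of_minorants_eq0 y : 0 <= ((y, 1) : U) ->
  (forall h, 0 <= h -> emb h <= ((y, 1) : U) -> h = 0) -> unital tau.
Proof.
rewrite unit_ge0E => /unit_coneP[_ [k fk]] /=; rewrite scale1r => yk min0.
have n0 := riesz_neg_ge0 y.
have yn : - y <= riesz_neg y by exact: leUl.
have fn : trunc_fixed tau (riesz_neg y).
  have [k0 _] := andP fk; apply: trunc_fixed_le fk => //.
  by rewrite leUx k0 -(riesz_subr_ge0 (- y)) opprK addrC yk.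
exists (riesz_neg y); split=> // f f0.
have ft := trunc_fixed_trunc tau f0.
apply/le_anti/andP; split; last first.
  apply: le_trunc => //; last exact: leIr.
  by apply: trunc_fixed_le fn; rewrite ?leIl // lexI n0.
rewrite lexI trunc_le // andbT.
set n := riesz_neg y in n0 yn fn *; set j := (tau f `|` n)%O.
have fj : trunc_fixed tau j by exact: trunc_fixedU.
have : j - n = 0.
  apply: min0; first by rewrite riesz_subr_ge0 leUr.
  rewrite unit_leE; apply/unit_coneP; split; first by rewrite /= subr0 ler01.
  exists j => //=; rewrite subr0 scale1r opprB -addrA subrK.
  by rewrite addrC -[y]opprK riesz_subr_ge0.
by move/eqP; rewrite subr_eq0 => /eqP <-; exact: leUl.
Qed.

End UnitizationFacts.

(** * The supremum norm on the unitization *)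

Section NormS.
Context {R : realType} {E : rieszType R} {tau : truncation E} {nE : E -> R}.
Context (hE : truncated_normed nE tau).
Local Notation U := (unitization tau).
Local Notation emb := (unit_emb tau).
Local Notation one := (unit_one tau).
Local Notation NS := (norm_S tau nE).
Implicit Types (u v : U) (x g h m : E) (a : R).
Let nN := truncated_normed_norm hE.

(** A supremum equal to [1] is not the default value [0], so the set of norms is
    bounded. *)
Lemma trunc_fixed_norm_le1 m : trunc_fixed tau m -> nE m <= 1.
Proof.
move=> /andP[m0 /eqP tm].
have [hs|ns] := pselect (has_sup [set nE (tau f) | f in [set f : E | 0 <= f]]%classic).
  rewrite -(truncated_normed_sup hE); apply: ub_le_sup; first exact: hs.2.
  by exists m => //; rewrite tm.
have := truncated_normed_sup hE; rewrite sup_out // => /esym/eqP.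
by rewrite oner_eq0.
Qed.

(** Makes the set defining the norm bounded, so that its supremum is genuine. *)
Lemma norm_S_bound u g : riesz_abs (emb g) <= riesz_abs u ->
  nE g <= nE u.1 + `|u.2|.
Proof.
move=> gu; have := le_trans gu (unit_abs_le u); rewrite unit_emb_abs.
move=> /unit_emb_leP[m fm gm].
rewrite -(lattice_norm_abs nN g) -(lattice_norm_abs nN u.1).
apply: le_trans (lattice_norm_mono nN _ _ (riesz_abs_ge0 g) gm) _.
apply: le_trans (lattice_normD nN _ _) _; rewrite lerD2l lattice_normZ //.
by rewrite normr_id ler_piMr // trunc_fixed_norm_le1.
Qed.

Lemma norm_S_ub u g : riesz_abs (emb g) <= riesz_abs u -> nE g <= NS u.
Proof.
move=> gu; apply: ub_le_sup; last by exists g.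
by exists (nE u.1 + `|u.2|) => _ [f fu <-]; exact: norm_S_bound.
Qed.

Lemma norm_S_le u a :
  (forall g, riesz_abs (emb g) <= riesz_abs u -> nE g <= a) -> NS u <= a.
Proof.
move=> H; apply: ge_sup; last by move=> _ [f fu <-]; exact: H.
by exists (nE 0), 0 => //=; rewrite riesz_abs_id ?riesz_abs_ge0.
Qed.

(** As [|g|] is in [E] with the norm of [g], positive elements suffice; for them
    meets with [|u|] are available. *)
Lemma norm_S_ub_pos u h : 0 <= h -> emb h <= riesz_abs u -> nE h <= NS u.
Proof. by move=> h0 hu; apply: norm_S_ub; rewrite riesz_abs_id ?unit_emb_ge0. Qed.

Lemma norm_S_le_pos u a :
  (forall h, 0 <= h -> emb h <= riesz_abs u -> nE h <= a) -> NS u <= a.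
Proof.
move=> H; apply: norm_S_le => g; rewrite unit_emb_abs -(lattice_norm_abs nN) => gu.
exact: H (riesz_abs_ge0 g) gu.
Qed.

Lemma norm_S_mono u v : riesz_abs u <= riesz_abs v -> NS u <= NS v.
Proof.
by move=> uv; apply: norm_S_le => g gu; apply: norm_S_ub; exact: le_trans gu uv.
Qed.

Lemma norm_S_emb x : NS (emb x) = nE x.
Proof.
apply/le_anti; rewrite norm_S_ub // andbT; apply: norm_S_le => g.
by rewrite !unit_emb_abs unit_emb_le; exact: lattice_norm_le.
Qed.

Lemma norm_S_one : NS one = 1.
Proof.
apply/le_anti/andP; split.
  apply: norm_S_le => g /norm_S_bound /=.
  by rewrite (lattice_norm0 nN) add0r normr1.
rewrite -(truncated_normed_sup hE); apply: ge_sup.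
  by exists (nE (tau 0)), 0 => //=.
move=> _ [f /= f0 <-]; apply: norm_S_ub_pos; first exact: trunc_ge0.
rewrite riesz_abs_id ?unit_one_ge0 // unit_leE; apply/unit_coneP.
split; first by rewrite /= subr0 ler01.
exists (tau f); first exact: trunc_fixed_trunc.
by rewrite /= subr0 sub0r scale1r addNr.
Qed.

(** Applied to [a^-1] as well, this inequality gives homogeneity. *)
Lemma norm_SZ_le a u : a != 0 -> NS (a *: u) <= `|a| * NS u.
Proof.
move=> a0; apply: norm_S_le => g gu.
rewrite -[g](scale1r g) -(divff a0) -scalerA lattice_normZ // ler_wpM2l //.
apply: norm_S_ub; rewrite -unit_embZ; apply: le_trans (riesz_absZ_le _ _) _.
have -> : riesz_abs u = `|a^-1| *: (`|a| *: riesz_abs u).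
  by rewrite scalerA -normrM mulVf // normr1 scale1r.
apply: riesz_ler_wpZ2l => //; exact: le_trans gu (riesz_absZ_le _ _).
Qed.

Lemma norm_SZ a u : NS (a *: u) = `|a| * NS u.
Proof.
have [->|a0] := eqVneq a 0.
  rewrite scale0r normr0 mul0r; have := norm_S_emb 0.
  by rewrite (lattice_norm0 nN).
apply/le_anti; rewrite norm_SZ_le //=.
rewrite -{1}[u](scale1r u) -(mulVf a0) -scalerA.
apply: le_trans (ler_wpM2l (normr_ge0 a) (norm_SZ_le _ _ (invr_neq0 a0))) _.
by rewrite mulrA -normrM divff // normr1 mul1r.
Qed.

(** Decompose [h <= |u| + |v|] through its meets with [|u|] and [|v|]; both are
    in [E] because [E] is an ideal. *)
Lemma norm_SD u v : NS (u + v) <= NS u + NS v.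
Proof.
apply: norm_S_le_pos => h h0 huv.
have [a a0 eu] := unit_emb_meet h _ h0 (riesz_abs_ge0 u).
have [b b0 ev] := unit_emb_meet h _ h0 (riesz_abs_ge0 v).
have hab : h <= a + b.
  rewrite -(@unit_emb_le _ _ tau).
  have -> : emb (a + b) = emb a + emb b by congr pair; rewrite addr0.
  rewrite -eu -ev; apply: riesz_meet_subadd; rewrite ?unit_emb_ge0 //.
  - exact: riesz_abs_ge0.
  - exact: riesz_abs_ge0.
  - exact: le_trans huv (riesz_absD _ _).
apply: le_trans (lattice_norm_mono nN _ _ h0 hab) _.
apply: le_trans (lattice_normD nN _ _) _.
by apply: lerD; apply: norm_S_ub_pos; rewrite // -?eu -?ev leIr.
Qed.

(** A nonzero real part of [|u|] is scaled to [1], which puts the scaled element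
    in the situation of [unital_of_minorants_eq0]. *)
Lemma norm_S_eq0 u : ~ unital tau -> NS u = 0 -> u = 0.
Proof.
move=> nu Nu; apply: riesz_abs0_eq.
have min0 h : 0 <= h -> emb h <= riesz_abs u -> h = 0.
  move=> h0 hu; apply: (lattice_norm_eq0 nN); apply/le_anti.
  by rewrite (lattice_norm_ge0 nN) andbT -Nu norm_S_ub_pos.
have := riesz_abs_ge0 u; set w := riesz_abs u in min0 * => w0.
have : 0 <= w.2 by exact: unit_le_snd w0.
rewrite le_eqVlt => /orP[/eqP s0|s0].
  have e : w = emb w.1 by case: w s0 {w0 min0} => y s /= <-.
  have w10 : 0 <= w.1 by rewrite -(@unit_emb_ge0 _ _ tau) -e.
  by rewrite e (min0 w.1) // -e.
have sV0 : 0 <= w.2^-1 by rewrite invr_ge0 ltW.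
have e : w.2^-1 *: w = ((w.2^-1 *: w.1, 1) : U).
  by congr pair; rewrite /GRing.scale /= mulVf // gt_eqF.
case: nu; apply: (unital_of_minorants_eq0 (w.2^-1 *: w.1)).
  by rewrite -e; exact: riesz_scale_ge0.
move=> h h0; rewrite -e => /(riesz_ler_wpZ2l (ltW s0)).
rewrite unit_embZ scalerA divff ?gt_eqF // scale1r => hw.
have /eqP := min0 _ (riesz_scale_ge0 _ _ (ltW s0) h0) hw.
by rewrite scaler_eq0 gt_eqF //= => /eqP.
Qed.

Lemma norm_S_lattice_norm : ~ unital tau -> lattice_norm NS.
Proof.
move=> nu; split; [|exact: norm_SZ|exact: norm_SD|exact: norm_S_mono].
by move=> u; exact: norm_S_eq0.
Qed.

Lemma norm_S_min (N : U -> R) : truncation_unitization_norm nE N ->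
  forall u, NS u <= N u.
Proof.
move=> [HN _ Nemb] u; apply: norm_S_le => g gu.
by rewrite -Nemb; exact: lattice_norm_le.
Qed.

Lemma norm_S_disjoint_join u v : M_norm nE -> (u `&` v)%O = 0 ->
  NS (u `|` v)%O = Num.max (NS u) (NS v).
Proof.
move=> [_ hM] d.
have u0 : 0 <= u by rewrite -d leIl.
have v0 : 0 <= v by rewrite -d leIr.
have j0 : 0 <= (u `|` v)%O by apply: le_trans u0 _; exact: leUl.
apply/le_anti/andP; split; last first.
  by rewrite ge_max; apply/andP; split; apply: norm_S_mono;
    rewrite !riesz_abs_id // ?leUl ?leUr.
apply: norm_S_le_pos => h h0; rewrite riesz_abs_id // => hj.
have eh0 : 0 <= emb h by rewrite unit_emb_ge0.
have [dm jm] := disjoint_meets_join _ _ _ eh0 d hj.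
have [a a0 eu] := unit_emb_meet h _ h0 u0.
have [b b0 ev] := unit_emb_meet h _ h0 v0.
have ua : emb a <= u by rewrite -eu leIr.
have vb : emb b <= v by rewrite -ev leIr.
have ab0 : (a `&` b)%O = 0.
  apply/le_anti/andP; split; last by rewrite lexI a0 b0.
  rewrite -(@unit_emb_le _ _ tau); suff: emb (a `&` b)%O <= (0 : U) by [].
  by rewrite -dm lexI eu ev !unit_emb_le leIl leIr.
have hab : h <= (a `|` b)%O.
  by rewrite -(@unit_emb_le _ _ tau) -jm leUx eu ev !unit_emb_le leUl leUr.
apply: le_trans (lattice_norm_mono nN _ _ h0 hab) _; rewrite hM //.
have au : nE a <= NS u by apply: norm_S_ub_pos; rewrite // riesz_abs_id.
have bv : nE b <= NS v by apply: norm_S_ub_pos; rewrite // riesz_abs_id.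
by rewrite ge_max !le_max au bv orbT.
Qed.

End NormS.

Theorem theorem3p9 (R : realType) (E : rieszType R) (tau : truncation E)
    (nE : E -> R)
    (hE : truncated_normed nE tau)
    (htau : ~ unital tau)
    (hM : M_norm nE) :
  smallest_truncation_unitization_norm nE (norm_S tau nE) /\
  M_norm (norm_S tau nE).
Proof.
have lN := norm_S_lattice_norm hE htau.
split; last by split=> // u v; exact: norm_S_disjoint_join.
split; last exact: norm_S_min.
by split=> //; [exact: norm_S_one | exact: norm_S_emb].
Qed.
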